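(* For any positive integer $k$ and any nonnegative integer $l$, the following identity holds in the ring $\Lambda$ of symmetric functions over $\mathbb{Q}(q,t)$: $$(-1)^{k}m_{2^{k}1^{l}}=\binom{k+l}{k}e_{2k+l}+q\sum_{i=1}^{k}\sum_{j=0}^{l}\binom{i-1+j}{i-1}C_{2i+j}\left((-1)^{k-i}m_{2^{k-i}1^{l-j}}\right).$$
   Context: $\Lambda$ is the ring of symmetric functions in $X=x_1+x_2+\cdots$ with coefficients in $\mathbb{Q}(q,t)$; $m_\lambda$, $e_n$, $h_n$, $p_n$ are the monomial, elementary, complete homogeneous and power sum symmetric functions ($e_0=h_0=1$). $m_{2^{k}1^{l}}$ is the monomial symmetric function of the partition with $k$ parts equal to $2$ and $l$ parts equal to $1$; for the empty partition it equals $1$. For $a\in\mathbb{Z}$, the operator $C_a:\Lambda\to\Lambda$ is the $\mathbb{Q}(q,t)$-linear operator $$C_{a}f[X]=\left(-\frac{1}{q}\right)^{a-1}f\left[X-\frac{1-\frac1q}{z}\right]\Omega[zX]\Bigg|_{z^a},$$ where $|_{z^a}$ means taking the coefficient of $z^a$, brackets denote plethystic substitution, and $\Omega[zX]=\sum_{n\ge 0}h_n z^n$. Explicitly, $f\left[X-\frac{1-1/q}{z}\right]$ is obtained by writing $f$ as a polynomial in the power sums $p_k$ and replacing each $p_k$ by $p_k-(1-q^{-k})z^{-k}$. *)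

(* Defs.v *)
From HB Require Import structures.
From mathcomp Require Import all_boot all_order all_fingroup all_algebra.
From mathcomp.classical Require Import boolp.
From mathcomp.multinomials Require Import mpoly.

Set Implicit Arguments.
Unset Strict Implicit.
Unset Printing Implicit Defensive.

Import GRing.Theory.
Local Open Scope ring_scope.

(** A symmetric function is a compatible family of symmetric polynomials
    [f n] in [n] variables, of bounded degree, where compatible means that
    setting the last variable of [f n.+1] to zero gives [f n].  In other
    words it is a symmetric formal power series of bounded degree in
    x_1, x_2, ..., given by its truncations.  All operations are computed
    componentwise. *)

Section Truncation.
Context {R : comNzRingType} {n : nat}.

Definition mtrunc (p : {mpoly R[n.+1]}) : {mpoly R[n]} :=
  p \mPo [tuple (if unlift ord_max i is Some j then 'X_j else 0) | i < n.+1].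

Lemma mtrunc_zmod : zmod_morphism mtrunc.
Proof. exact: comp_mpolyB. Qed.

Lemma mtrunc_monoid : monoid_morphism mtrunc.
Proof. by split; [exact: comp_mpoly1 | move=> p r; exact: rmorphM]. Qed.

Lemma mtrunc_scalable : scalable mtrunc.
Proof. by move=> c p; exact: comp_mpolyZ. Qed.

HB.instance Definition _ :=
  GRing.isZmodMorphism.Build {mpoly R[n.+1]} {mpoly R[n]} mtrunc mtrunc_zmod.
HB.instance Definition _ :=
  GRing.isMonoidMorphism.Build {mpoly R[n.+1]} {mpoly R[n]} mtrunc
    mtrunc_monoid.
HB.instance Definition _ :=
  GRing.isScalable.Build R {mpoly R[n.+1]} {mpoly R[n]} *:%R mtrunc
    mtrunc_scalable.

Lemma mtruncX_max : mtrunc 'X_ord_max = 0.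
Proof. by rewrite /mtrunc comp_mpolyXU -tnth_nth tnth_mktuple unlift_none. Qed.

Lemma mtruncX_widen (i : 'I_n) : mtrunc 'X_(widen_ord (leqnSn n) i) = 'X_i.
Proof.
rewrite /mtrunc comp_mpolyXU -tnth_nth tnth_mktuple.
have -> : widen_ord (leqnSn n) i = lift ord_max i.
  by apply/val_inj; rewrite /= /bump leqNgt ltn_ord.
by rewrite liftK.
Qed.

Lemma mcoeff_mtrunc (p : {mpoly R[n.+1]}) (m : 'X_{1..n}) :
  (mtrunc p)@_m = p@_(mnmwiden m).
Proof.
rewrite (mpolyE p) (linear_sum mtrunc) !(raddf_sum (mcoeff _)) /=.
apply: eq_bigr => m' _.
rewrite mtrunc_scalable !mcoeffZ; congr (_ * _).
rewrite mcoeffX {1}mpolyXE_id rmorph_prod /= big_ord_recr /= rmorphXn /=.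
rewrite mtruncX_max.
under eq_bigr => i _ do rewrite rmorphXn /= mtruncX_widen.
have [m'0|m'n0] := eqVneq (m' ord_max) 0%N; last first.
  rewrite expr0n (negbTE m'n0) mulr0 mcoeff0.
  case: eqP => // E; move: m'n0.
  by rewrite E mnmwiden_ordmax.
rewrite m'0 expr0 mulr1.
pose m1 : 'X_{1..n} := [multinom m' (widen_ord (leqnSn n) i) | i < n].
have -> : \prod_(i < n) 'X_i ^+ m' (widen_ord (leqnSn n) i) = 'X_[m1]
    :> {mpoly R[n]}.
  by rewrite mpolyXE_id; apply: eq_bigr => i _; rewrite mnmE.
have -> : m' = mnmwiden m1.
  apply/mnmP => i; case: (unliftP ord_max i) => [j ->|->].
    have -> : lift ord_max j = widen_ord (leqnSn n) j.
      by apply/val_inj; rewrite /= /bump leqNgt ltn_ord.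
    by rewrite mnmwiden_widen mnmE.
  by rewrite mnmwiden_ordmax.
by rewrite mcoeffX (inj_eq (@inj_mnmwiden n)).
Qed.

End Truncation.

Section SymFun.
Context (R : comNzRingType).

Definition is_symfun (f : forall n, {mpoly R[n]}) : Prop :=
  [/\ forall n, f n \is symmetric,
      forall n, mtrunc (f n.+1) = f n &
      exists d, forall n, (msize (f n) <= d)%N].

Record symfun := SymFun {
  sf_val :> forall n, {mpoly R[n]};
  sf_valP : is_symfun sf_val }.

HB.instance Definition _ := gen_eqMixin symfun.
HB.instance Definition _ := gen_choiceMixin symfun.

Lemma symfunP (f g : symfun) : (forall n, f n = g n) -> f = g.
Proof.
case: f g => [f Pf] [g Pg] /= fg.
have E : f = g by apply: functional_extensionality_dep.
by rewrite E in Pf *; rewrite (Prop_irrelevance Pf Pg).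
Qed.

Lemma is_symfunC (c : R) : is_symfun (fun n => c%:MP).
Proof.
split=> [n|n|].
- by rewrite -alg_mpolyC; apply/rpredZ/rpred1.
- by rewrite -alg_mpolyC linearZ rmorph1 /= alg_mpolyC.
by exists 1%N => n; rewrite msizeC leq_b1.
Qed.

Lemma is_symfunD (f g : symfun) : is_symfun (fun n => f n + g n).
Proof.
case: f g => [f [sf tf [d df]]] [g [sg tg [d' dg]]] /=; split=> [n|n|].
- by apply: rpredD; [exact: sf | exact: sg].
- by rewrite rmorphD /= tf tg.
exists (maxn d d') => n; apply: leq_trans (msizeD_le _ _) _.
by rewrite geq_max !leq_max df dg orbT.
Qed.

Lemma is_symfunZ (c : R) (f : symfun) : is_symfun (fun n => c *: f n).
Proof.
case: f => [f [sf tf [d df]]] /=; split=> [n|n|].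
- by apply: rpredZ; exact: sf.
- by rewrite linearZ /= tf.
by exists d => n; apply: leq_trans (msizeZ_le _ _) _.
Qed.

Lemma is_symfunN (f : symfun) : is_symfun (fun n => - f n).
Proof.
case: f => [f [sf tf [d df]]] /=; split=> [n|n|].
- by rewrite rpredN; exact: sf.
- by rewrite rmorphN /= tf.
by exists d => n; rewrite msizeN.
Qed.

Lemma is_symfunM (f g : symfun) : is_symfun (fun n => f n * g n).
Proof.
case: f g => [f [sf tf [d df]]] [g [sg tg [d' dg]]] /=; split=> [n|n|].
- by apply: rpredM; [exact: sf | exact: sg].
- by rewrite rmorphM /= tf tg.
exists (d + d').+1%N => n; apply: leq_trans (msizeM_le _ _) _.
by rewrite ltnS leq_add.
Qed.

Definition sf_const c := SymFun (is_symfunC c).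
Definition sf_add f g := SymFun (is_symfunD f g).
Definition sf_opp f := SymFun (is_symfunN f).
Definition sf_mul f g := SymFun (is_symfunM f g).
Definition sf_scale c f := SymFun (is_symfunZ c f).

Fact sf_addA : associative sf_add.
Proof. by move=> f g h; apply: symfunP => n; exact: addrA. Qed.
Fact sf_addC : commutative sf_add.
Proof. by move=> f g; apply: symfunP => n; exact: addrC. Qed.
Fact sf_add0 : left_id (sf_const 0) sf_add.
Proof. by move=> f; apply: symfunP => n; rewrite /= mpolyC0 add0r. Qed.
Fact sf_addN : left_inverse (sf_const 0) sf_opp sf_add.
Proof. by move=> f; apply: symfunP => n; rewrite /= mpolyC0 addNr. Qed.

HB.instance Definition _ :=
  GRing.isZmodule.Build symfun sf_addA sf_addC sf_add0 sf_addN.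

Fact sf_mulA : associative sf_mul.
Proof. by move=> f g h; apply: symfunP => n; exact: mulrA. Qed.
Fact sf_mulC : commutative sf_mul.
Proof. by move=> f g; apply: symfunP => n; exact: mulrC. Qed.
Fact sf_mul1 : left_id (sf_const 1) sf_mul.
Proof. by move=> f; apply: symfunP => n; rewrite /= mpolyC1 mul1r. Qed.
Fact sf_mulDl : left_distributive sf_mul sf_add.
Proof. by move=> f g h; apply: symfunP => n; exact: mulrDl. Qed.
Fact sf_1neq0 : sf_const 1 != 0.
Proof.
apply/eqP => /(congr1 (fun f : symfun => (f 0%N)@_0%MM)) /eqP.
by rewrite /= !mcoeffC eqxx !mulr1 (negbTE (oner_neq0 R)).
Qed.

HB.instance Definition _ := GRing.Zmodule_isComNzRing.Build symfun
  sf_mulA sf_mulC sf_mul1 sf_mulDl sf_1neq0.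

Fact sf_scaleA c d f : sf_scale c (sf_scale d f) = sf_scale (c * d) f.
Proof. by apply: symfunP => n; exact: scalerA. Qed.
Fact sf_scale1 : left_id 1 sf_scale.
Proof. by move=> f; apply: symfunP => n; exact: scale1r. Qed.
Fact sf_scaleDr : right_distributive sf_scale +%R.
Proof. by move=> c f g; apply: symfunP => n; exact: scalerDr. Qed.
Fact sf_scaleDl f : {morph sf_scale^~ f : c d / c + d}.
Proof. by move=> c d; apply: symfunP => n; exact: scalerDl. Qed.

HB.instance Definition _ := GRing.Zmodule_isLmodule.Build R symfun
  sf_scaleA sf_scale1 sf_scaleDr sf_scaleDl.

Fact sf_scaleAl c (f g : symfun) : c *: (f * g) = (c *: f) * g.
Proof. by apply: symfunP => n; exact: scalerAl. Qed.

HB.instance Definition _ :=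
  GRing.Lmodule_isLalgebra.Build R symfun sf_scaleAl.
HB.instance Definition _ := GRing.Lalgebra_isComAlgebra.Build R symfun.

End SymFun.

Section Monosum.
Context {R : comNzRingType}.

Lemma mcoeff_monosum n b (P : pred 'X_{1..n}) (m : 'X_{1..n}) :
  (\sum_(m' : 'X_{1..n < b} | P m') 'X_[R, m'])@_m = ((mdeg m < b)%N && P m)%:R.
Proof.
rewrite raddf_sum /=; under eq_bigr => i _ do rewrite mcoeffX.
case: ltnP => [lt_mb|le_bm] /=; last first.
  rewrite big1 // => i _; case: eqP => // E.
  by move: le_bm; rewrite -E leqNgt bmdeg.
have [Pm|nPm] := boolP (P m); last first.
  by rewrite big1 // => i Pi; case: eqP => // E; move: nPm; rewrite -E Pi.
rewrite (bigD1 (BMultinom lt_mb)) //= eqxx big1 ?addr0 // => i /andP[_ ne].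
by case: eqP => // E; move: ne; rewrite bmeqP /= E eqxx.
Qed.

Lemma is_symfun_coeff (f : forall n, {mpoly R[n]})
    (c : forall n, pred 'X_{1..n}) (d : nat) :
    (forall n m, (f n)@_m = (c n m)%:R) ->
    (forall n (m : 'X_{1..n}) (s : 'S_n), c n [multinom m (s i) | i < n] = c n m) ->
    (forall n m, c n.+1 (mnmwiden m) = c n m) ->
    (forall n m, c n m -> (mdeg m <= d)%N) ->
  is_symfun f.
Proof.
move=> fE cs cw cd; split=> [n|n|].
- by apply/issymP => s; apply/mpolyP => m; rewrite mcoeff_sym !fE cs.
- by apply/mpolyP => m; rewrite mcoeff_mtrunc !fE cw.
exists d.+1 => n; rewrite msizeE; apply/bigmax_leqP_seq => m + _.
rewrite mcoeff_msupp fE ltnS; case: (boolP (c n m)) => [/cd //|_].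
by rewrite eqxx.
Qed.

Lemma mdeg_mnmwiden n (m : 'X_{1..n}) : mdeg (mnmwiden m) = mdeg m.
Proof.
rewrite !mdegE big_ord_recr /= mnmwiden_ordmax addn0.
by apply: eq_bigr => i _; rewrite mnmwiden_widen.
Qed.

End Monosum.

(** The nonzero exponents of a monomial; sorted, they form a partition. *)
Definition mparts n (m : 'X_{1..n}) : seq nat :=
  [seq a <- (m : seq nat) | a != 0%N].

Lemma mparts_mperm n (m : 'X_{1..n}) (s : 'S_n) :
  perm_eq (mparts [multinom m (s i) | i < n]) (mparts m).
Proof.
apply: perm_filter; apply/tuple_permP; exists s.
rewrite /=; congr (tval _); apply: eq_from_tnth => i; rewrite !tnth_mktuple.
Qed.

Lemma mparts_widen n (m : 'X_{1..n}) : mparts (mnmwiden m) = mparts m.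
Proof. by rewrite /mparts /= filter_rcons. Qed.

Lemma sumn_mparts n (m : 'X_{1..n}) : sumn (mparts m) = mdeg m.
Proof.
rewrite /mparts /mdeg sumnE big_filter big_mkcond /=.
by apply: eq_bigr => i _; case: eqP.
Qed.

Section Classical.
Context (R : comNzRingType).

(** [la] is the list of (positive) parts of a partition. *)
Definition sfm_val (la : seq nat) n : {mpoly R[n]} :=
  \sum_(m : 'X_{1..n < (sumn la).+1} | perm_eq (mparts m) la) 'X_[m].

Definition sfh_val (d : nat) n : {mpoly R[n]} :=
  \sum_(m : 'X_{1..n < d.+1} | mdeg m == d) 'X_[m].

Lemma sfm_subproof la : is_symfun (sfm_val la).
Proof.
apply: (@is_symfun_coeff _ _ (fun n m => perm_eq (mparts m) la) (sumn la)).
- move=> n m; rewrite /sfm_val (mcoeff_monosum _ (fun m => perm_eq (mparts m) la)); congr (nat_of_bool _)%:R.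
  case: (boolP (perm_eq _ _)) => [/perm_sumn E|_]; last by rewrite andbF.
  by rewrite -E sumn_mparts ltnSn.
- by move=> n m s; rewrite (permPl (mparts_mperm m s)).
- by move=> n m; rewrite mparts_widen.
- by move=> n m /perm_sumn <-; rewrite sumn_mparts.
Qed.

Lemma sfh_subproof d : is_symfun (sfh_val d).
Proof.
apply: (@is_symfun_coeff _ _ (fun n m => mdeg m == d) d).
- move=> n m; rewrite /sfh_val (mcoeff_monosum _ (fun m => mdeg m == d)); congr (nat_of_bool _)%:R.
  by case: eqP => [->|_]; rewrite ?ltnSn ?andbF.
- by move=> n m s; rewrite mdeg_mperm.
- by move=> n m; rewrite mdeg_mnmwiden.
- by move=> n m /eqP ->.
Qed.

Lemma sfe_subproof d : is_symfun (fun n => mesym n R d).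
Proof.
apply: (@is_symfun_coeff _ _ (fun n => mechar d) d).
- by move=> n m; rewrite mcoeff_mesym.
- by move=> n m s; rewrite mperm_mechar.
- move=> n m; rewrite /mechar mdeg_mnmwiden; congr (_ && _).
  apply/forallP/forallP => H i.
    by have := H (widen_ord (leqnSn n) i); rewrite mnmwiden_widen.
  case: (unliftP ord_max i) => [j ->|->]; last by rewrite mnmwiden_ordmax.
  have -> : lift ord_max j = widen_ord (leqnSn n) j.
    by apply/val_inj; rewrite /= /bump leqNgt ltn_ord.
  by rewrite mnmwiden_widen.
- by move=> n m /andP[/eqP ->].
Qed.

Lemma sfp_subproof d : is_symfun (fun n => \sum_(i < n) ('X_i : {mpoly R[n]}) ^+ d.+1).
Proof.
split=> [n|n|].
- apply/issymP => s; rewrite rmorph_sum /= [RHS](reindex_inj (@perm_inj _ s)).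
  apply: eq_bigr => i _; rewrite rmorphXn /=; congr (_ ^+ _).
  by rewrite /msym mmapX mmap1U.
- rewrite rmorph_sum big_ord_recr /= rmorphXn /= mtruncX_max expr0n addr0.
  by apply: eq_bigr => i _; rewrite rmorphXn /= mtruncX_widen.
exists d.+2 => n; apply: leq_trans (msize_sum _ _ _) _.
apply/bigmax_leqP => i _; rewrite mpolyXn msizeX mdegMn mdeg1 mul1n.
by [].
Qed.

Definition sf_m la : symfun R := SymFun (sfm_subproof la).
Definition sf_e d : symfun R := SymFun (sfe_subproof d).
Definition sf_h d : symfun R := SymFun (sfh_subproof d).
(** [sf_p d] is p_{d+1}: in infinitely many variables p_0 does not exist. *)
Definition sf_p d : symfun R := SymFun (sfp_subproof d).

End Classical.

Section Operators.
Context {F : fieldType}.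
Implicit Types (f : symfun F) (q : F).

(** A polynomial P(y_1, ..., y_d), where y_k stands for p_k (so that the
    variable of index i : 'I_d stands for p_{i+1}). *)
Definition ppoly : Type := {d : nat & {mpoly F[d]}}.

Definition ppoly_eval (S : nzRingType) (iota : F -> S) (y : nat -> S)
    (P : ppoly) : S :=
  mmap iota (fun i => y i) (projT2 P).

(** A polynomial in the power sums representing [f].  When [F] has
    characteristic zero the power sums are algebraically independent
    generators of the algebra of symmetric functions, so such a polynomial
    always exists and is unique up to adding unused variables. *)
Definition in_psums f : ppoly :=
  if pselect (exists P : ppoly, ppoly_eval (in_alg (symfun F)) (sf_p F) P = f) is left ex
  then projT1 (cid ex) else existT (fun d => {mpoly F[d]}) 0%N 0.

(** f[X - (1 - 1/q)/z], as a polynomial in w = 1/z (here ['X]) with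
    coefficients in the symmetric functions; p_k is replaced with
    p_k - (1 - q^-k) w^k. *)
Definition pleth_shift q f : {poly symfun F} :=
  ppoly_eval (fun c : F => (c%:A : symfun F)%:P)
    (fun i => (sf_p F i)%:P - ((1 - q ^- i.+1)%:A)%:P * 'X^(i.+1))
    (in_psums f).

Definition sf_hz (n : int) : symfun F :=
  if n is Posz d then sf_h F d else 0.

(** C_a: the coefficient of z^a in (sum_j g_j z^-j) (sum_n h_n z^n) is
    sum_j g_j h_{a+j}. *)
Definition Cop q (a : int) f : symfun F :=
  let g := pleth_shift q f in
  (- q^-1) ^ (a - 1) *: \sum_(j < size g) g`_j * sf_hz (a + j%:Z).

End Operators.

Definition Qqt : fieldType := {fraction {mpoly rat[2]}}.
Definition qvar : Qqt := FracField.tofrac 'X_0.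
Definition tvar : Qqt := FracField.tofrac 'X_1.

(* Main.v *)
From HB Require Import structures.
Require Import Defs.
From mathcomp Require Import all_boot all_order all_algebra.
From mathcomp Require Import ring zify.
From mathcomp.classical Require Import boolp.
From mathcomp.multinomials Require Import mpoly.

(** Write M_{k,l} = (-1)^k m_{2^k 1^l}.  In the commuting variables a and b, the
    generating function of the M_{k,l} is M = prod_x (1 + b x - a x^2).

    The shift X -> X - w + w/q multiplies M by (1 + b w/q - a w^2/q^2) and
    divides it by 1 + b w - a w^2, so the shifted functions g_{k,l} satisfy a
    three-term linear relation with the M_{k,l} ([pleth_shift_signed_m]).  To
    see this without any uniqueness statement for expressions in power sums,
    apply the ring morphism X -> X + w, w -> w: it turns the shift of f into f
    with one extra variable w/q, which is directly computable
    ([set_last_pleth_shift], [set_last_signed_m]), and it is injective because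
    it is the identity in lowest order in w ([set_last_w_inj]).  This only uses
    that M_{k,l} is some polynomial in the power sums
    ([is_psum_poly_signed_m]), which follows from a version of Newton's
    identities in characteristic zero.

    Pairing powers of w with the h_n, a factor w raises the index of C by one.
    Hence multiplication by a and by b acts on the families C_n(M_{k,l}) and
    h_n M_{k,l} by index shifts, up to powers of q.  The relation says that
    1 - q b - q^2 a on the first family agrees with 1 - b - a on the second, so
    dividing by both gives a/(1 - b - a) on the first and
    a/(1 - q b - q^2 a) on the second ([pairing_inv]).  The binomial
    coefficients of the theorem are those of a/(1 - b - a), and all powers of q
    cancel ([sum_shifted_pair]).

    What remains no longer involves q:
      M_{k,l} + sum_{i >= 1, j} (-1)^j C(i-1+j, i-1) h_{2i+j} M_{k-i,l-j}
        = C(k+l, k) e_{2k+l}   ([lucas_symfun]).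
    Let T be the matrix with rows (b, a) and (1, 0), so that
    det (1 + x T) = 1 + b x - a x^2.  With E = sum_n e_n T^n one has det E = M,
    and sum_n (-1)^n h_n T^n is the inverse of E.  Therefore
    M * sum_n (-1)^n h_n T^n is the adjugate of E, and the identity is the
    lower right entry of this equation ([coef_prod_quad_geom]). *)

Set Implicit Arguments.
Unset Strict Implicit.
Unset Printing Implicit Defensive.

Import GRing.Theory.
Local Open Scope ring_scope.

(** * Expanding products of one polynomial per variable *)

Section Expansion.
Context (F : comNzRingType) (n : nat).

Definition mnm_ffun N (f : {ffun 'I_n -> 'I_N}) : 'X_{1..n} :=
  [multinom (f i : nat) | i < n].

(** Common source of the expansions of the generating polynomials of m, e and h:
    choosing a power of each variable amounts to choosing a monomial whose
    exponents are below [N].  [iota] embeds the polynomials in the x_i into the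
    ring in which the generating variables live. *)
Lemma prod_sum_powers (S : comNzRingType) (iota : {rmorphism {mpoly F[n]} -> S})
    (w : nat -> S) N :
  \prod_(i < n) \sum_(j < N) w j * iota 'X_i ^+ j
  = \sum_(f : {ffun 'I_n -> 'I_N})
      (\prod_(i < n) w (f i)) * iota 'X_[mnm_ffun f].
Proof.
rewrite bigA_distr_bigA /=; apply: eq_bigr => f _; rewrite big_split /=.
congr (_ * _); rewrite mpolyXE_id rmorph_prod; apply: eq_bigr => i _.
by rewrite mnmE rmorphXn.
Qed.

Lemma mcoeff_sum_ffun N (Q : pred 'X_{1..n}) (m : 'X_{1..n}) :
  (\sum_(f : {ffun 'I_n -> 'I_N} | Q (mnm_ffun f)) 'X_[F, mnm_ffun f])@_m
  = ([forall i, (m i < N)%N] && Q m)%:R.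
Proof.
rewrite raddf_sum /=; under eq_bigr => f _ do rewrite mcoeffX.
have [mN|mN] := boolP [forall i, (m i < N)%N]; last first.
  rewrite big1 // => f _; case: eqP => // E; move: mN; rewrite -E.
  by case/forallP => i; rewrite mnmE.
pose f0 := [ffun i => Ordinal (forallP mN i)].
have mf0 : mnm_ffun f0 = m by apply/mnmP => i; rewrite mnmE ffunE.
have uniq_f0 f : mnm_ffun f = m -> f = f0.
  move=> E; apply/ffunP => i; apply/val_inj; rewrite ffunE /= -E.
  by rewrite mnmE.
have [Qm|nQm] := boolP (Q m).
  rewrite (bigD1 f0) ?mf0 //= eqxx big1 ?addr0 // => f /andP[_ ne].
  by case: eqP => // /uniq_f0 E; rewrite E eqxx in ne.
rewrite big1 // => f Qf; case: eqP => // E; move: nQm.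
by rewrite -E Qf.
Qed.

End Expansion.

Definition count_exp n (m : 'X_{1..n}) a := (\sum_(i < n) (m i == a))%N.

(** A partition 2^k 1^l is recognised by the multiplicities of 2 and 1 once all
    entries are below 3; this is the form in which the choices of exponents of
    a product of factors [quad] present themselves. *)
Lemma perm_twos_ones (s : seq nat) k l :
  perm_eq [seq a <- s | a != 0%N] (nseq k 2%N ++ nseq l 1%N)
  = [&& all (fun a => a < 3)%N s, count_mem 2%N s == k & count_mem 1%N s == l].
Proof.
have norm : all (fun a => a < 3)%N s ->
    perm_eq [seq a <- s | a != 0%N]
      (nseq (count_mem 2%N s) 2%N ++ nseq (count_mem 1%N s) 1%N).
  elim: s => //= a s IH /andP[a3 /IH {}IH].
  case: a a3 => [|[|[|//]]] _ /=; rewrite ?add0n ?add1n //=.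
    by rewrite perm_sym perm_catC /= perm_cons perm_catC perm_sym.
  by rewrite perm_cons.
apply/idP/and3P => [E|[s3 /eqP <- /eqP <-]]; last exact: norm.
have cnt b : b != 0%N -> count_mem b s = count_mem b (nseq k 2%N ++ nseq l 1%N).
  move=> b0; rewrite -(seq.permP E) count_filter; apply: eq_count => a /=.
  by case: eqP => // ->; rewrite b0.
split.
- apply/allP => a sa; have [->//|a0] := eqVneq a 0%N.
  have : a \in [seq a <- s | a != 0%N] by rewrite mem_filter a0.
  by rewrite (perm_mem E) mem_cat !mem_nseq; case/orP => /andP[_ /eqP ->].
- by rewrite cnt // count_cat !count_nseq /= mul1n mul0n addn0.
- by rewrite cnt // count_cat !count_nseq /= mul1n mul0n add0n.
Qed.

Lemma mparts_twos_ones n (m : 'X_{1..n}) k l :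
  perm_eq (mparts m) (nseq k 2%N ++ nseq l 1%N)
  = [forall i, (m i < 3)%N] && ((count_exp m 2 == k) && (count_exp m 1 == l)).
Proof.
have cntE a : count_mem a (m : seq nat) = count_exp m a.
  rewrite -sumn_count sumnE big_map -[X in \sum_(j <- X) _](map_tnth_enum m).
  by rewrite big_map big_enum /=.
rewrite /mparts perm_twos_ones !cntE; congr (_ && _).
apply/allP/forallP => [H i|H a /tnthP[i ->]]; last exact: H.
by apply: H; rewrite (mnm_nth 0%N) -tnth_nth mem_tnth.
Qed.

(** The factor 1 + b x - a x^2 of the generating polynomial of the M_{k,l}; the
    outer variable is a and the inner one is b. *)
Definition quad {A : comNzRingType} (x : A) : {poly {poly A}} :=
  1 + ('X * x%:P)%:P - 'X * (x ^+ 2)%:P%:P.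

Section Coefficients.
Context (F : comNzRingType) (n : nat).
Let A := {mpoly F[n]}.

Definition signed_m k l : symfun F :=
  (-1) ^+ k *: sf_m F (nseq k 2%N ++ nseq l 1%N).

Lemma coef_prod_quad k l :
  (\prod_(i < n) quad ('X_i : A))`_k`_l = signed_m k l n.
Proof.
(* 1 + b x - a x^2 as a sum of three powers of x, with weights 1, b and - a. *)
pose w (j : nat) : {poly {poly A}} := (- 'X) ^+ (j == 2%N) * 'X%:P ^+ (j == 1%N).
pose iota : A -> {poly {poly A}} := polyC \o polyC.
have -> : \prod_(i < n) quad ('X_i : A)
    = \prod_(i < n) \sum_(j < 3) w j * iota 'X_i ^+ j.
  apply: eq_bigr => i _; rewrite !big_ord_recl big_ord0 /w /iota /quad /= /bump /=.
  rewrite !polyCM !expr0 !expr1; ring.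
rewrite prod_sum_powers.
under eq_bigr => f _ do rewrite big_split /= !prodrXr.
rewrite !coef_sum -/iota.
rewrite (eq_bigr (fun f => if (count_exp (mnm_ffun f) 2 == k)
    && (count_exp (mnm_ffun f) 1 == l) then (-1) ^+ k * 'X_[F, mnm_ffun f] else 0)).
  rewrite -big_mkcond -big_distrr /=.
  rewrite -mul_mpolyC rmorphXn rmorphN1.
  congr (_ * _).
  apply/mpolyP => m; rewrite (@mcoeff_sum_ffun _ _ _ (fun m =>
    (count_exp m 2 == k) && (count_exp m 1 == l))) -mparts_twos_ones.
  rewrite /sfm_val (mcoeff_monosum _ (fun m => perm_eq (mparts m) _)).
  case: (boolP (perm_eq _ _)) => [/perm_sumn E|_]; last by rewrite andbF.
  by rewrite -E sumn_mparts ltnSn.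
move=> f _.
have cE a : (\sum_(i < n) (f i == a :> nat))%N = count_exp (mnm_ffun f) a.
  by apply: eq_bigr => i _; rewrite mnmE.
rewrite !cE /iota /=.
set c2 := count_exp _ 2; set c1 := count_exp _ 1.
have -> : (- 'X) ^+ c2 * 'X%:P ^+ c1 * ('X_[mnm_ffun f])%:P%:P
    = (((-1) ^+ c2 * 'X_[mnm_ffun f])%:P * 'X ^+ c1)%:P * 'X ^+ c2 :> {poly {poly A}}.
  by rewrite (exprNn 'X) !(rmorphM, rmorphXn, rmorphN, rmorph1) /=; ring.
rewrite coefCM coefXn mulr_natr coefMn coefCM coefXn (eq_sym k) (eq_sym l).
case: (eqVneq c1 l) => _; case: (eqVneq c2 k) => [<-|_] /=;
  by rewrite ?(mulr0n, mulr1n, mulr0, mulr1).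
Qed.

Lemma coef_prod_lin d :
  (\prod_(i < n) (1 + 'X * ('X_i : A)%:P))`_d = sf_e F d n.
Proof.
have -> : \prod_(i < n) (1 + 'X * ('X_i : A)%:P)
    = \prod_(i < n) \sum_(j < 2) 'X ^+ j * ('X_i)%:P ^+ j.
  by apply: eq_bigr => i _; rewrite !big_ord_recl big_ord0 /= !expr0 !expr1; ring.
rewrite (prod_sum_powers polyC (fun j => 'X^j)) coef_sum /=.
rewrite (eq_bigr (fun f => if mdeg (mnm_ffun f) == d then 'X_[F, mnm_ffun f] else 0)).
  rewrite -big_mkcond; apply/mpolyP => m.
  rewrite (@mcoeff_sum_ffun _ _ _ (fun m => mdeg m == d)) mcoeff_mesym /mechar andbC.
  by congr (nat_of_bool (_ && _))%:R; apply: eq_forallb => i; rewrite ltnS.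
move=> f _; rewrite prodrXr coefMC coefXn mdegE.
rewrite (eq_bigr (fun i => mnm_ffun f i)); last by move=> i _; rewrite mnmE.
by rewrite eq_sym; case: eqP; rewrite ?(mul0r, mul1r).
Qed.

(** The truncated geometric factors stand for prod_x 1/(1 + x t); the truncation
    order is invisible in degrees below [N]. *)
Lemma coef_prod_geom N d : (d < N)%N ->
  (\prod_(i < n) \sum_(j < N) (- ('X * ('X_i : A)%:P)) ^+ j)`_d
  = (-1) ^+ d * sf_h F d n.
Proof.
move=> dN; under eq_bigr => i _ do under eq_bigr => j _ do
  rewrite -mulNr exprMn.
rewrite (prod_sum_powers polyC (fun j => (- 'X)^+j)) coef_sum /=.
rewrite (eq_bigr (fun f => if mdeg (mnm_ffun f) == d
   then (-1) ^+ d * 'X_[F, mnm_ffun f] else 0)).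
  rewrite -big_mkcond -big_distrr /=; congr (_ * _); apply/mpolyP => m.
  rewrite (@mcoeff_sum_ffun _ _ _ (fun m => mdeg m == d)).
  rewrite /sfh_val (mcoeff_monosum _ (fun m => mdeg m == d)).
  case: eqP dN => [<-|_] dN; last by rewrite !andbF.
  rewrite ltnSn !andbT /=; suff -> : [forall i, (m i < N)%N] by [].
  apply/forallP => i; apply: leq_ltn_trans dN.
  by rewrite mdegE (bigD1 i) //= leq_addr.
move=> f _; rewrite prodrXr coefMC (exprNn 'X) -(rmorph_sign polyC) coefCM coefXn mdegE.
rewrite (eq_bigr (fun i => mnm_ffun f i)); last by move=> i _; rewrite mnmE.
by rewrite eq_sym; case: eqP => [->|]; rewrite ?(mulr0, mul0r, mulr1).
Qed.

End Coefficients.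

(** * Evaluation at a companion matrix *)

Lemma mulmx22E (R : comNzRingType) (M N : 'M[R]_2) i j :
  (M *m N) i j = M i 0 * N 0 j + M i 1 * N 1 j.
Proof.
rewrite mxE !big_ord_recl big_ord0 addr0; congr (_ + M i _ * N _ j);
  exact/val_inj.
Qed.

Lemma det_mx22 (R : comNzRingType) (M : 'M[R]_2) :
  \det M = M 0 0 * M 1 1 - M 0 1 * M 1 0.
Proof.
rewrite (expand_det_row _ 0) !big_ord_recl big_ord0 /cofactor !det_mx11 !mxE /=.
have -> : lift 0 0 = 1 :> 'I_2 by exact/val_inj.
have -> : lift 1 0 = 0 :> 'I_2 by exact/val_inj.
by rewrite /bump /= !addn0 expr0 expr1 addr0 mul1r mulN1r mulrN.
Qed.

Section CompanionMatrix.
Context {A : comNzRingType}.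
Local Notation S := {poly {poly A}}.
Let a : S := 'X.
Let b : S := 'X%:P.

(** The matrix T with characteristic polynomial z^2 - b z - a: its eigenvalues
    are the alpha, beta with alpha + beta = b and alpha beta = - a, which split
    1 + b x - a x^2 as (1 + alpha x) (1 + beta x). *)
Definition companion : 'M[S]_2 :=
  \matrix_(i, j) if i == 0 then (if j == 0 then b else a) else (j == 0)%:R.

(** The Lucas polynomials (alpha^n - beta^n) / (alpha - beta). *)
Fixpoint lucas n : S :=
  match n with
  | 0%N => 0
  | n'.+1 => match n' with 0%N => 1 | n''.+1 => b * lucas n' + a * lucas n'' end
  end.

(** Only the bidegrees of weight [n] occur, where a has weight 2 and b has
    weight 1; the recursion is Pascal's rule. *)
Lemma coef_lucas n k l :
  (lucas n.+1)`_k`_l = ('C(k + l, k) * (2 * k + l == n))%:R.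
Proof.
have step m : lucas m.+2 = b * lucas m.+1 + a * lucas m by [].
suff H : (forall k l, (lucas n.+1)`_k`_l = ('C(k + l, k) * (2 * k + l == n))%:R)
  /\ (forall k l, (lucas n.+2)`_k`_l = ('C(k + l, k) * (2 * k + l == n.+1))%:R).
  exact: H.1.
elim: n {k l} => [|n [IH1 IH2]].
  have H1 k l : (lucas 1)`_k`_l = ('C(k + l, k) * (2 * k + l == 0))%:R.
    rewrite /= coef1; case: k => [|k]; last by rewrite /= coef0 muln0.
    by rewrite /= coef1 bin0 mul1n; case: l.
  split=> // k l; rewrite step mulr0 addr0 mulr1 /b coefC.
  case: k => [|k]; last first.
    by rewrite /= coef0 (_ : (_ == 1)%N = false) ?muln0 //; lia.
  by rewrite coefX bin0 mul1n.
split=> // k l; rewrite step coefD coefD /b /a coefCM coefXM coefXM !IH2.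
case: k => [|k] /=.
  rewrite coef0 addr0; case: l => [|l] /=; first by rewrite !bin0 !mul1n.
  by rewrite !add0n eqSS !bin0.
rewrite IH1; case: l => [|l] /=.
  rewrite !addn0 !binn !mul1n add0r.
  have -> //: (2 * k.+1 + 0 == n.+2)%N = (2 * k + 0 == n)%N.
  by apply/eqP/eqP; lia.
rewrite -natrD.
have -> : (2 * k.+1 + l == n.+1)%N = (2 * k + l.+1 == n)%N by apply/eqP/eqP; lia.
have -> : (2 * k.+1 + l.+1 == n.+2)%N = (2 * k + l.+1 == n)%N.
  by apply/eqP/eqP; lia.
by rewrite -mulnDl -(addSnnS k l) (addnS k.+1) binS.
Qed.

Lemma expr_companion n :
  [/\ (companion ^+ n) 0 0 = lucas n.+1,
      (companion ^+ n) 0 1 = a * lucas n,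
      (companion ^+ n) 1 0 = lucas n &
      (companion ^+ n) 1 1 = if n is n'.+1 then a * lucas n' else 1].
Proof.
elim: n => [|n [IH00 IH01 IH10 IH11]].
  by split; rewrite expr0 mxE //= mulr0.
by split; rewrite exprS mulmx22E !mxE /= ?IH00 ?IH01 ?IH10 ?IH11;
  case: n {IH00 IH01 IH10 IH11} => [|n] /=; ring.
Qed.

Definition at_companion : {rmorphism {poly A} -> 'M[S]_2} :=
  horner_mx companion \o map_poly (polyC \o polyC).

Lemma at_companionC c : at_companion c%:P = c%:P%:P%:M.
Proof. by rewrite /= map_polyC horner_mx_C. Qed.

Lemma at_companionX : at_companion 'X = companion.
Proof. by rewrite /= map_polyX horner_mx_X. Qed.

Lemma at_companionE P i j :
  at_companion P i j
  = \sum_(m < size P) (P`_m)%:P%:P * (companion ^+ m) i j.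
Proof.
rewrite -{1}[P]coefK poly_def rmorph_sum summxE; apply: eq_bigr => m _.
rewrite -mul_polyC rmorphM rmorphXn /= map_polyC map_polyX horner_mx_C horner_mx_X.
by rewrite -[_ * _]/(_ *m _) mul_scalar_mx mxE.
Qed.

(** Selects the one degree that has a given weight, also when that degree lies
    beyond the size of [P]. *)
Lemma sum_size_coef (P : {poly A}) (c d : nat) :
  \sum_(m < size P) P`_m * (c * (d == m :> nat))%:R = c%:R * P`_d.
Proof.
have [dP|dP] := ltnP d (size P).
  rewrite (bigD1 (Ordinal dP)) //= eqxx muln1 big1 ?addr0 1?mulrC // => m ne.
  have -> : (d == m :> nat) = false by apply: contraNF ne => /eqP E; apply/eqP/val_inj.
  by rewrite muln0 mulr0.
rewrite nth_default // mulr0 big1 // => m _.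
by rewrite gtn_eqF ?muln0 ?mulr0 // (leq_trans _ dP).
Qed.

Lemma coef_at_companion00 P k l :
  (at_companion P 0 0)`_k`_l = 'C(k + l, k)%:R * P`_(2 * k + l).
Proof.
rewrite at_companionE !coef_sum -sum_size_coef; apply: eq_bigr => m _.
by rewrite !coefCM; case: (expr_companion m) => -> _ _ _; rewrite coef_lucas.
Qed.

(** The coefficients of (1 - b)/(1 - a - b). *)
Definition lucas_coef k l : nat :=
  if k is k'.+1 then 'C(k' + l, k') else (l == 0%N).

Lemma coef_at_companion11 P k l :
  (at_companion P 1 1)`_k`_l = (lucas_coef k l)%:R * P`_(2 * k + l).
Proof.
rewrite at_companionE !coef_sum -sum_size_coef; apply: eq_bigr => m _.
rewrite !coefCM; case: (expr_companion m) => _ _ _ ->; congr (_ * _).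
case: (nat_of_ord m) k => [|[|m']] [|k] /=.
- by rewrite coef1 /= coef1; case: l.
- by rewrite coef1 /= coef0 muln0.
- by rewrite mulr0 coef0 coef0; case: l.
- by rewrite mulr0 !coef0 (_ : (_ == 1)%N = false) ?muln0 //; apply/eqP; lia.
- by rewrite coefXM /= coef0; case: l.
- rewrite coefXM /= coef_lucas.
  have -> //: (2 * k.+1 + l == m'.+2)%N = (2 * k + l == m')%N.
  by apply/eqP/eqP; lia.
Qed.

Lemma coef_at_companion01 P k l :
  (at_companion P 0 1)`_k`_l =
  if k is k'.+1 then 'C(k' + l, k')%:R * P`_(2 * k' + l).+1 else 0.
Proof.
rewrite at_companionE !coef_sum.
case: k => [|k].
  rewrite big1 // => m _; case: (expr_companion m) => _ -> _ _.
  by rewrite !coefCM coefXM coef0 mulr0.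
rewrite -sum_size_coef; apply: eq_bigr => m _.
rewrite !coefCM; case: (expr_companion m) => _ -> _ _; congr (_ * _).
by rewrite coefXM /=; case: (nat_of_ord m) => [|m'] /=;
  rewrite ?coef_lucas // !coef0 muln0.
Qed.

End CompanionMatrix.

(** * Relating e, h and the monomial functions of 2^k 1^l *)

Section LucasIdentity.
Context {A : comNzRingType} {I : finType} (x : I -> A).

Lemma det_at_companion_lin :
  \det (at_companion (\prod_i (1 + 'X * (x i)%:P))) = \prod_i quad (x i).
Proof.
rewrite rmorph_prod (big_morph _ (@det_mulmx _ 2) (det1 _ 2)).
apply: eq_bigr => i _; rewrite rmorphD rmorph1 rmorphM.
rewrite at_companionC at_companionX -[_ * _%:M]/(_ *m _%:M).
rewrite scalar_mxC mul_scalar_mx det_mx22 !mxE /=.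
by rewrite /quad !(rmorphM, rmorphXn) /=; ring.
Qed.

(** The truncated form of E(t) H(-t) = 1. *)
Lemma prod_lin_geom N :
  exists Z, (\prod_i (1 + 'X * (x i)%:P)) *
    (\prod_i \sum_(j < N) (- ('X * (x i)%:P)) ^+ j) = 1 + 'X^N * Z.
Proof.
rewrite -big_split /=; elim/big_ind: _ => [|P Q [Z ->] [Z' ->]|i _].
- by exists 0; rewrite mulr0 addr0.
- by exists (Z + Z' + 'X^N * Z * Z'); ring.
exists (- (- (x i)%:P) ^+ N).
pose y := - ('X * (x i)%:P); rewrite -/y.
have -> : 1 + 'X * (x i)%:P = - (y - 1) by rewrite /y; ring.
by rewrite mulNr -subrX1 /y -mulrN exprMn; ring.
Qed.

Lemma coefM_eq0 (P Q : {poly {poly A}}) k l :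
    (forall i j, (i <= k)%N -> (j <= l)%N -> P`_i`_j = 0) ->
  (P * Q)`_k`_l = 0.
Proof.
move=> P0; rewrite coefM coef_sum big1 // => i _; rewrite coefM big1 // => j _.
by rewrite P0 ?mul0r // -ltnS.
Qed.

(** The entry (2, 2) of det(E) H = adj(E), where E and H are the values at the
    companion matrix of prod (1 + x_i t) and of its truncated inverse.  The error
    term of the truncation has weight at least [N], too large to contribute to
    the coefficient of a^k b^l. *)
Lemma coef_prod_quad_geom N k l : (2 * k + l < N)%N ->
  \sum_(i < k.+1) \sum_(j < l.+1)
     (lucas_coef i j)%:R
       * (\prod_i \sum_(j < N) (- ('X * (x i)%:P)) ^+ j)`_(2 * i + j)
       * (\prod_i quad (x i))`_(k - i)`_(l - j)
  = 'C(k + l, k)%:R * (\prod_i (1 + 'X * (x i)%:P))`_(2 * k + l).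
Proof.
move=> klN; have [Z] := prod_lin_geom N; rewrite -det_at_companion_lin.
set E := \prod_i (1 + _); set H := \prod_i _ => EH.
pose e := at_companion E; pose h := at_companion H.
pose w := at_companion ('X^N * Z).
have eh : e *m h = 1%:M + w by rewrite -[LHS](rmorphM at_companion) EH rmorphD rmorph1.
have eh01 : e 0 0 * h 0 1 + e 0 1 * h 1 1 = w 0 1.
  by rewrite -mulmx22E eh !mxE add0r.
have eh11 : e 1 0 * h 0 1 + e 1 1 * h 1 1 = 1 + w 1 1.
  by rewrite -mulmx22E eh !mxE.
(* Multiply E H = 1 + w on the left by the second row of adj(E). *)
have deth : h 1 1 * \det e = e 0 0 + (w 1 1 * e 0 0 - w 0 1 * e 1 0).
  rewrite -[w 1 1](addKr 1) -eh11 -eh01 det_mx22; ring.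
have XNZ m : (m < N)%N -> ('X^N * Z)`_m = 0 by rewrite coefXnM => ->.
have := congr1 (fun P : {poly {poly A}} => P`_k`_l) deth.
rewrite !coefD !coefN (@coefM_eq0 (w 1 1)); last first.
  by move=> i j ik jl; rewrite coef_at_companion11 XNZ ?mulr0 //; lia.
rewrite (@coefM_eq0 (w 0 1)); last first.
  move=> [|i] j ik jl; rewrite coef_at_companion01 ?XNZ ?mulr0 //; lia.
rewrite subr0 addr0 coef_at_companion00 => <-.
rewrite coefM coef_sum; apply: eq_bigr => i _; rewrite coefM.
by apply: eq_bigr => j _; rewrite coef_at_companion11.
Qed.

End LucasIdentity.

(** * Adding a variable *)

Section LastVariable.
Context {F : fieldType}.

Definition sf_at n (f : symfun F) : {mpoly F[n]} := f n.

Lemma sf_at_zmod n : zmod_morphism (sf_at n).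
Proof. by []. Qed.
Lemma sf_at_monoid n : monoid_morphism (sf_at n).
Proof. by split => //; rewrite /sf_at /= mpolyC1. Qed.
HB.instance Definition _ n :=
  GRing.isZmodMorphism.Build (symfun F) {mpoly F[n]} (sf_at n) (@sf_at_zmod n).
HB.instance Definition _ n :=
  GRing.isMonoidMorphism.Build (symfun F) {mpoly F[n]} (sf_at n) (@sf_at_monoid n).

(** A ring morphism only sees the images of the coefficients and of the
    variables: this is what makes every identity below independent of the
    polynomial chosen to represent a symmetric function. *)
Lemma mmap_morph (S S' : nzRingType) (phi : {rmorphism S -> S'}) d (iota : F -> S)
    (y : 'I_d -> S) P :
  phi (mmap iota y P) = mmap (fun c => phi (iota c)) (fun i => phi (y i)) P.
Proof.
rewrite /mmap rmorph_sum; apply: eq_bigr => m _; rewrite rmorphM /=; congr (_ * _).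
by rewrite /mmap1 rmorph_prod; apply: eq_bigr => i _; rewrite rmorphXn.
Qed.

Lemma eq_mmap (S : nzRingType) d (iota iota' : F -> S) (y y' : 'I_d -> S) P :
  iota =1 iota' -> y =1 y' -> mmap iota y P = mmap iota' y' P.
Proof.
move=> Ei Ey; apply: eq_bigr => m _; rewrite Ei /mmap1; congr (_ * _).
by apply: eq_bigr => i _; rewrite Ey.
Qed.

Section SetLast.
Context {n : nat} (c : F).

(** The last variable becomes [c] w, where w is the polynomial variable of the
    target; on symmetric functions this is f -> f[X + c w]. *)
Definition set_last : {mpoly F[n.+1]} -> {poly {mpoly F[n]}} :=
  mmap (polyC \o @mpolyC n F)
    (fun i => if unlift ord_max i is Some j then ('X_j)%:P else c%:MP%:P * 'X).

Lemma set_last_zmod : zmod_morphism set_last.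
Proof. by move=> p r; rewrite /set_last raddfB. Qed.
Lemma set_last_monoid : monoid_morphism set_last.
Proof. by split; [exact: rmorph1 | exact: rmorphM]. Qed.
HB.instance Definition _ :=
  GRing.isZmodMorphism.Build {mpoly F[n.+1]} {poly {mpoly F[n]}} set_last
    set_last_zmod.
HB.instance Definition _ :=
  GRing.isMonoidMorphism.Build {mpoly F[n.+1]} {poly {mpoly F[n]}} set_last
    set_last_monoid.

Lemma set_last_const a : set_last a%:MP = a%:MP%:P.
Proof. by rewrite /set_last mmapC. Qed.

Lemma set_last_max : set_last 'X_ord_max = c%:MP%:P * 'X.
Proof. by rewrite /set_last mmapX mmap1U unlift_none. Qed.

Lemma set_last_widen (i : 'I_n) : set_last 'X_(widen_ord (leqnSn n) i) = ('X_i)%:P.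
Proof.
have -> : widen_ord (leqnSn n) i = lift ord_max i.
  by apply/val_inj; rewrite /= /bump leqNgt ltn_ord.
by rewrite /set_last mmapX mmap1U liftK.
Qed.

Lemma set_last_psum d :
  set_last (sf_p F d n.+1) = (sf_p F d n)%:P + (c ^+ d.+1)%:MP%:P * 'X^(d.+1).
Proof.
rewrite [sf_val _ n.+1]/= rmorph_sum big_ord_recr /=.
rewrite [set_last ('X_ord_max ^+ _)]rmorphXn /= set_last_max exprMn.
rewrite [in RHS]rmorph_sum /=; congr (_ + _ * _).
  by apply: eq_bigr => i _; rewrite [LHS]rmorphXn /= set_last_widen [RHS]rmorphXn.
by rewrite -[LHS](rmorphXn polyC) -[in LHS](rmorphXn (@mpolyC n F)).
Qed.

(** Setting w to zero removes the last variable. *)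
Lemma coef0_set_last p : (set_last p)`_0 = mtrunc p.
Proof.
rewrite -horner_coef0 -/(horner_eval 0 _) mmap_morph; apply: eq_mmap.
  by move=> a /=; rewrite /horner_eval hornerC.
move=> i /=; rewrite tnth_mktuple /horner_eval.
by case: unliftP => [j|] _; rewrite ?hornerC // hornerM hornerX mulr0.
Qed.

End SetLast.

Lemma coef_mul_quad (A : comNzRingType) (P : {poly {poly A}}) y k l :
  (P * quad y)`_k`_l = P`_k`_l + y * (if (l == 0)%N then 0 else P`_k`_l.-1)
    - y ^+ 2 * (if (k == 0)%N then 0 else P`_k.-1`_l).
Proof.
rewrite /quad mulrBr mulrDr mulr1 !coefD !coefN; congr (_ + _ - _).
  by rewrite coefMC mulrA coefMC coefMX mulrC.
rewrite mulrA !coefMC coefMX mulrC; congr (_ * _).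
by case: (k == 0)%N; rewrite ?coef0.
Qed.

Lemma map_quad (A B : comNzRingType) (phi : {rmorphism A -> B}) y :
  map_poly (map_poly phi) (quad y) = quad (phi y).
Proof.
rewrite /quad rmorphB rmorphD rmorph1 /= map_polyC rmorphM /= map_polyX.
rewrite rmorphM /= map_polyX !map_polyC /= map_polyC; congr (_ - 'X * _%:P%:P).
exact: rmorphXn.
Qed.

Lemma map_prod_quad (A B : comNzRingType) (phi : {rmorphism A -> B}) m (y : 'I_m -> A) :
  map_poly (map_poly phi) (\prod_i quad (y i)) = \prod_i quad (phi (y i)).
Proof. by rewrite rmorph_prod; apply: eq_bigr => i _; apply: map_quad. Qed.

Lemma morph_coef_prod_quad (A A' B : comNzRingType) (phi : {rmorphism A -> B})
    (psi : {rmorphism A' -> B}) n (y : 'I_n.+1 -> A) (z : 'I_n -> A') k l :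
    (forall i, phi (y (widen_ord (leqnSn n) i)) = psi (z i)) ->
  let Q := \prod_i quad (z i) in
  phi (\prod_i quad (y i))`_k`_l = psi Q`_k`_l
    + phi (y ord_max) * (if (l == 0)%N then 0 else psi Q`_k`_l.-1)
    - phi (y ord_max) ^+ 2 * (if (k == 0)%N then 0 else psi Q`_k.-1`_l).
Proof.
move=> yz Q; have E : map_poly (map_poly phi) (\prod_i quad (y i))
    = map_poly (map_poly psi) Q * quad (phi (y ord_max)).
  rewrite !map_prod_quad big_ord_recr /=; congr (_ * _).
  by apply: eq_bigr => i _; rewrite yz.
move/(congr1 (fun P : {poly {poly B}} => P`_k`_l)): E.
by rewrite coef_mul_quad !(coef_map (map_poly phi), coef_map (map_poly psi)) /=
  !(coef_map phi, coef_map psi).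
Qed.

Lemma set_last_signed_m (c : F) n k l :
  set_last c (signed_m F k l n.+1) = (signed_m F k l n)%:P
   + c%:MP%:P * 'X * (if (l == 0)%N then 0 else (signed_m F k l.-1 n)%:P)
   - (c%:MP%:P * 'X) ^+ 2 * (if (k == 0)%N then 0 else (signed_m F k.-1 l n)%:P).
Proof.
have := @morph_coef_prod_quad {mpoly F[n.+1]} {mpoly F[n]}
  {poly {mpoly F[n]}} (set_last c) polyC n (fun i => 'X_i)
  (fun i => 'X_i) k l (set_last_widen c).
by rewrite /= set_last_max !coef_prod_quad.
Qed.

Lemma sf_atA a n : (a%:A : symfun F) n = a%:MP.
Proof. by rewrite -alg_mpolyC /= -mpolyC1. Qed.

(** The morphism f -> f[X + w], w -> w, in [n] variables. *)
Definition set_last_w n : {rmorphism {poly symfun F} -> {poly {mpoly F[n]}}} :=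
  horner_eval 'X \o map_poly (set_last 1 \o @sf_at n.+1).

Lemma set_last_wC n f : set_last_w n f%:P = set_last 1 (f n.+1).
Proof. by rewrite /= map_polyC /horner_eval hornerC. Qed.

Lemma set_last_wX n : set_last_w n 'X = 'X.
Proof. by rewrite /= map_polyX /horner_eval hornerX. Qed.

Lemma coef0_set_last_w n g : (set_last_w n g)`_0 = g`_0 n.
Proof.
elim/poly_ind: g => [|p f _]; first by rewrite rmorph0 !coef0.
rewrite rmorphD rmorphM set_last_wX set_last_wC !coefD !coefMX !add0r coef0_set_last.
by rewrite coefC; case: (sf_valP f) => _ ->.
Qed.

(** The lowest nonzero coefficient of [g] in w survives: it is the lowest
    coefficient of the image, by stability under removal of a variable. *)
Lemma set_last_w_inj g : (forall n, set_last_w n g = 0) -> g = 0.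
Proof.
move=> g0; apply/polyP => i; rewrite coef0; elim/ltn_ind: i => i IH.
(* The coefficients below [i] vanish by induction. *)
have gE : g = drop_poly i g * 'X^i.
  rewrite -{1}(poly_take_drop i g) (_ : take_poly i g = 0) ?add0r //.
  by apply/polyP => j; rewrite coef_take_poly coef0; case: ltnP => // /IH.
rewrite -[i]add0n -coef_drop_poly; apply: symfunP => n.
rewrite -coef0_set_last_w; have /eqP := g0 n.
rewrite {1}gE rmorphM rmorphXn set_last_wX mulf_eq0 expf_eq0 polyX_eq0 andbF orbF.
by move/eqP => ->; rewrite coef0 /= mpolyC0.
Qed.

Definition is_psum_poly (f : symfun F) :=
  exists P : ppoly, ppoly_eval (in_alg (symfun F)) (sf_p F) P = f.

Lemma in_psumsP f : is_psum_poly f ->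
  ppoly_eval (in_alg (symfun F)) (sf_p F) (in_psums f) = f.
Proof. by rewrite /in_psums; case: pselect => // ex _; case: (cid ex). Qed.

(** Adding the variable w undoes the subtraction of w in X - w + w/q, leaving
    f[X + w/q]. *)
Lemma set_last_pleth_shift q f n : is_psum_poly f ->
  set_last_w n (pleth_shift q f) = set_last q^-1 (f n.+1).
Proof.
move=> /in_psumsP {2}<-; rewrite -[_ n.+1]/(sf_at n.+1 _) /pleth_shift /ppoly_eval.
rewrite !mmap_morph; apply: eq_mmap => [a|i].
  by rewrite set_last_wC [RHS]/= mpolyC1 alg_mpolyC sf_atA !set_last_const.
rewrite -[RHS]/(set_last q^-1 (sf_p F i n.+1)) set_last_psum.
rewrite [LHS]rmorphB rmorphM rmorphXn !set_last_wC set_last_wX.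
rewrite set_last_psum expr1n sf_atA set_last_const exprVn.
by rewrite mpolyCB polyCB mpolyC1; ring.
Qed.

(** The coefficient of a^k b^l in
    g (1 + b w - a w^2) = M (1 + b w/q - a w^2/q^2), where g is the shift of M.
    After X -> X + w both sides are M (1 + b w - a w^2) (1 + b w/q - a w^2/q^2). *)
Lemma pleth_shift_signed_m q k l :
  (forall k l, is_psum_poly (signed_m F k l)) ->
  let g k l := pleth_shift q (signed_m F k l) in
  let M k l := (signed_m F k l)%:P in
  g k l + 'X * (if (l == 0)%N then 0 else g k l.-1)
    - 'X ^+ 2 * (if (k == 0)%N then 0 else g k.-1 l)
  = M k l + (q^-1)%:A%:P * 'X * (if (l == 0)%N then 0 else M k l.-1)
    - ((q^-1)%:A%:P * 'X) ^+ 2 * (if (k == 0)%N then 0 else M k.-1 l).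
Proof.
move=> psum g M; apply/eqP; rewrite -subr_eq0; apply/eqP.
apply: set_last_w_inj => n.
have gE k' l' : set_last_w n (g k' l') = set_last q^-1 (signed_m F k' l' n.+1).
  exact/set_last_pleth_shift/psum.
have ME k' l' : set_last_w n (M k' l') = set_last 1 (signed_m F k' l' n.+1).
  exact: set_last_wC.
have ifE (b : bool) P : set_last_w n (if b then 0 else P)
    = if b then 0 else set_last_w n P by case: b; rewrite ?rmorph0.
have qE : set_last_w n (q^-1)%:A%:P = (q^-1)%:MP%:P.
  by rewrite set_last_wC sf_atA set_last_const.
(* Hiding the values of the functions lets the ring tactic see atoms. *)
have [m SE] : exists m : nat -> nat -> {poly {mpoly F[n]}}, forall c k l,
    set_last c (signed_m F k l n.+1) = m k l
    + c%:MP%:P * 'X * (if (l == 0)%N then 0 else m k l.-1)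
    - (c%:MP%:P * 'X) ^+ 2 * (if (k == 0)%N then 0 else m k.-1 l).
  exists (fun k l => (signed_m F k l n)%:P) => c k' l'.
  exact: set_last_signed_m.
rewrite rmorphB [X in X - _]rmorphB [X in _ - X]rmorphB !rmorphD.
rewrite !(rmorphM, rmorphXn) !ifE !gE !ME set_last_wX qE !SE.
rewrite mpolyC1 polyC1 mul1r.
move: (q^-1)%:MP%:P => c.
by case: k l => [|[|k]] [|[|l]] /=; ring.
Qed.

End LastVariable.

(** * Newton's identities *)

Lemma deriv_prod (S : comNzRingType) (I : finType) (D : I -> {poly S}) :
  (\prod_i D i)^`() = \sum_i (D i)^`() * \prod_(j | j != i) D j.
Proof.
elim: (index_enum I) (index_enum_uniq I) => [|a r IH] /=; first by rewrite !big_nil derivC.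
case/andP => ar ur; rewrite !big_cons derivM IH // eqxx; congr (_ * _ + _).
  by rewrite big_seq_cond [RHS]big_seq_cond; apply: eq_bigl => j;
    case: eqP => [->|]; rewrite ?(negbTE ar) ?andbF ?andbT.
rewrite mulr_sumr big_seq_cond [RHS]big_seq_cond; apply: eq_bigr => i /andP[ir _].
have a_i : a != i by apply: contraNneq ar => ->.
by rewrite big_cons a_i; exact: mulrCA.
Qed.

Lemma coef0_quad (A : comNzRingType) (x : A) : (quad x)`_0 = 1 + 'X * x%:P.
Proof. by rewrite /quad coefB coefD coef1 coefC coefXM subr0. Qed.

Lemma deriv_quad (A : comNzRingType) (x : A) : (quad x)^`() = - (x ^+ 2)%:P%:P.
Proof.
rewrite /quad derivB derivD !derivM derivX -polyC1 !derivC.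
by rewrite !(mulr0, addr0, mul1r, add0r).
Qed.

Lemma deriv_lin (A : comNzRingType) (x : A) : (1 + 'X * x%:P)^`() = x%:P.
Proof.
rewrite derivD derivM derivX -polyC1 !derivC.
by rewrite !(mulr0, addr0, mul1r, add0r).
Qed.

Section PowerSumPolynomials.
Context {F : fieldType}.
Implicit Types f g : symfun F.
Local Notation psum_eval := (mmap (in_alg (symfun F)) (fun i => sf_p F i)).

Lemma is_psum_poly_widen f : is_psum_poly f ->
  exists d0, forall d, (d0 <= d)%N -> exists P : {mpoly F[d]}, psum_eval P = f.
Proof.
case=> [[d0 P] Pf]; exists d0 => d le_d.
exists (mmap (@mpolyC d F) (fun i => 'X_(widen_ord le_d i)) P).
rewrite -[RHS]Pf /ppoly_eval mmap_morph; apply: eq_mmap => [c|i] /=.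
  by rewrite mmapC.
by rewrite mmapX mmap1U.
Qed.

Lemma is_psum_polyI d (P : {mpoly F[d]}) f : psum_eval P = f -> is_psum_poly f.
Proof. by move=> Pf; exists (existT (fun d => {mpoly F[d]}) d P). Qed.

Lemma is_psum_poly2 f g : is_psum_poly f -> is_psum_poly g ->
  exists d, exists P : {mpoly F[d]}, exists2 Q : {mpoly F[d]},
    psum_eval P = f & psum_eval Q = g.
Proof.
move=> /is_psum_poly_widen[d ex_f] /is_psum_poly_widen[d' ex_g].
have [P Pf] := ex_f _ (leq_maxl d d'); have [Q Qg] := ex_g _ (leq_maxr d d').
by exists (maxn d d'), P, Q.
Qed.

Lemma is_psum_polyD f g : is_psum_poly f -> is_psum_poly g -> is_psum_poly (f + g).
Proof.
move=> pf pg; have [d [P [Q <- <-]]] := is_psum_poly2 pf pg.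
by apply: (@is_psum_polyI _ (P + Q)); rewrite rmorphD.
Qed.

Lemma is_psum_polyM f g : is_psum_poly f -> is_psum_poly g -> is_psum_poly (f * g).
Proof.
move=> pf pg; have [d [P [Q <- <-]]] := is_psum_poly2 pf pg.
by apply: (@is_psum_polyI _ (P * Q)); rewrite rmorphM.
Qed.

Lemma is_psum_polyA (c : F) : is_psum_poly (c%:A : symfun F).
Proof. by apply: (@is_psum_polyI 0 c%:MP); rewrite mmapC. Qed.

Lemma is_psum_polyZ (c : F) f : is_psum_poly f -> is_psum_poly (c *: f).
Proof. by rewrite -mulr_algl; apply: is_psum_polyM; apply: is_psum_polyA. Qed.

Lemma is_psum_poly_psum d : is_psum_poly (sf_p F d).
Proof. by apply: (@is_psum_polyI d.+1 'X_ord_max); rewrite mmapX mmap1U. Qed.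

Lemma is_psum_poly0 : is_psum_poly (0 : symfun F).
Proof. by rewrite -(scale0r 1); apply: is_psum_polyA. Qed.

(** What differentiating M, or multiplying it by a power sum, produces: a sum over
    the factor that is singled out. *)
Definition pointed r k l n : {mpoly F[n]} :=
  \sum_(i < n) 'X_i ^+ r * (\prod_(j < n | j != i) quad ('X_j : {mpoly F[n]}))`_k`_l.

(** In p_{r+1} M, restore the factor of index i missing from the product. *)
Lemma psum_mul_signed_m r k l n :
  sf_p F r n * signed_m F k l n = pointed r.+1 k l n
    + (if (l == 0)%N then 0 else pointed r.+2 k l.-1 n)
    - (if (k == 0)%N then 0 else pointed r.+3 k.-1 l n).
Proof.
rewrite -coef_prod_quad [X in X * _]/= mulr_suml.
have if_sum (b : bool) (G : 'I_n -> {mpoly F[n]}) :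
    (if b then 0 else \sum_i G i) = \sum_i if b then 0 else G i.
  by case: b => //; rewrite big1.
rewrite /pointed !if_sum -big_split -sumrB; apply: eq_bigr => i _ /=.
rewrite (bigD1 i) //= [quad _ * _]mulrC coef_mul_quad.
by rewrite !exprS; case: (l == 0)%N; case: (k == 0)%N; ring.
Qed.

(** Solve [psum_mul_signed_m] for its first term; k + l decreases in the other
    two. *)
Lemma is_psum_poly_pointed r k l :
    (forall k' l', (k' <= k)%N -> (l' <= l)%N -> is_psum_poly (signed_m F k' l')) ->
  exists2 g : symfun F, is_psum_poly g & forall n, g n = pointed r.+1 k l n.
Proof.
have [s] := ubnP (k + l); elim: s r k l => // s IH r k l lt_s psum.
have [g1 psum_g1 g1E] : exists2 g : symfun F, is_psum_poly g &
    forall n, g n = if (l == 0)%N then 0 else pointed r.+2 k l.-1 n.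
  case: l lt_s psum => [|l] lt_s psum.
    by exists 0 => [|n]; [exact: is_psum_poly0 | rewrite /= mpolyC0].
  apply: IH => [|k' l' kk ll]; first by lia.
  by apply: psum => //; apply: leqW.
have [g2 psum_g2 g2E] : exists2 g : symfun F, is_psum_poly g &
    forall n, g n = if (k == 0)%N then 0 else pointed r.+3 k.-1 l n.
  case: k lt_s psum {psum_g1 g1E} => [|k] lt_s psum.
    by exists 0 => [|n]; [exact: is_psum_poly0 | rewrite /= mpolyC0].
  apply: IH => [|k' l' kk ll]; first by lia.
  by apply: psum => //; apply: leqW.
exists (sf_p F r * signed_m F k l + (-1) *: g1 + g2) => [|n].
  apply: is_psum_polyD psum_g2; apply: is_psum_polyD (is_psum_polyZ _ psum_g1).
  by apply: is_psum_polyM (is_psum_poly_psum _) _; apply: psum.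
have -> : (sf_p F r * signed_m F k l + (-1) *: g1 + g2) n
    = sf_p F r n * signed_m F k l n - g1 n + g2 n by rewrite scaleN1r.
by rewrite psum_mul_signed_m g1E g2E; ring.
Qed.

Lemma signed_m00 : signed_m F 0 0 = 1.
Proof.
apply: symfunP => n; rewrite -coef_prod_quad coef0_prod coef0_prod big1.
  by rewrite /= mpolyC1.
by move=> i _; rewrite coef0_quad coefD coef1 coefXM addr0.
Qed.

(** The derivative of M with respect to a. *)
Lemma coefS_signed_m k l n :
  k.+1%:R *: signed_m F k.+1 l n = - pointed 2 k l n.
Proof.
have := coef_deriv (\prod_(i < n) quad ('X_i : {mpoly F[n]})) k.
rewrite deriv_prod => /(congr1 (fun P : {poly {mpoly F[n]}} => P`_l)).
rewrite coefMn coef_prod_quad scaler_nat => <-; rewrite !coef_sum -sumrN.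
apply: eq_bigr => i _; set P := \prod_(j | _) _.
by rewrite deriv_quad mulNr !coefN !coefCM.
Qed.

(** The derivative with respect to b of M at a = 0. *)
Lemma coef0S_signed_m l n :
  l.+1%:R *: signed_m F 0 l.+1 n = pointed 1 0 l n.
Proof.
have := coef_deriv (\prod_(i < n) (quad ('X_i : {mpoly F[n]}))`_0) l.
rewrite deriv_prod -coef0_prod coef_prod_quad scaler_nat => <-; rewrite !coef_sum.
by apply: eq_bigr => i _; rewrite -coef0_prod coef0_quad deriv_lin coefCM.
Qed.

(** The only place where characteristic zero matters: the derivatives determine
    (k + 1) M_{k+1,l} and (l + 1) M_{0,l+1} by polynomials in the power sums. *)
Lemma is_psum_poly_signed_m k l :
  (forall m, m.+1%:R != 0 :> F) -> is_psum_poly (signed_m F k l).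
Proof.
move=> char0; have [s] := ubnP (k + l); elim: s k l => // s IH k l lt_s.
case: k lt_s => [|k] lt_s.
  case: l lt_s => [|l] lt_s.
    by rewrite signed_m00 -[1]scale1r; apply: is_psum_polyA.
  have [k' l' kk ll|g psum_g gE] := @is_psum_poly_pointed 0 0 l.
    by apply: IH; lia.
  suff -> : signed_m F 0 l.+1 = l.+1%:R^-1 *: g by apply: is_psum_polyZ.
  apply: symfunP => n; rewrite [RHS]/= gE -coef0S_signed_m scalerA mulVf //.
  by rewrite scale1r.
have [k' l' kk ll|g psum_g gE] := @is_psum_poly_pointed 1 k l.
  by apply: IH; lia.
suff -> : signed_m F k.+1 l = - k.+1%:R^-1 *: g by apply: is_psum_polyZ.
apply: symfunP => n; rewrite [RHS]/= gE -[pointed _ _ _ _]opprK -coefS_signed_m.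
by rewrite scaleNr scalerN opprK scalerA mulVf // scale1r.
Qed.

End PowerSumPolynomials.

(** * Inverting linear relations between shifted families *)

Section Pairing.
Context {F : fieldType} {V : lmodType F}.
Implicit Types (P Q : {poly {poly F}}) (G D : nat -> nat -> nat -> V).

(** The linear form a^i b^j -> G_{2i+j, k-i, l-j} on polynomials in a (outer
    variable) and b.  The first index of G counts the powers of w = 1/z, of
    which a brings two and b one. *)
Definition pairing k l G P : V :=
  \sum_(i < k.+1) \sum_(j < l.+1) P`_i`_j *: G (2 * i + j)%N (k - i)%N (l - j)%N.

(** The families that multiplication by a and by b turn G into. *)
Definition shift_a G a k l := if (k == 0)%N then 0 else G a.+2 k.-1 l.
Definition shift_b G a k l := if (l == 0)%N then 0 else G a.+1 k l.-1.

Lemma pairingD k l G P Q : pairing k l G (P + Q) = pairing k l G P + pairing k l G Q.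
Proof.
rewrite -big_split; apply: eq_bigr => i _; rewrite -big_split; apply: eq_bigr => j _.
by rewrite /= !coefD scalerDl.
Qed.

Lemma pairingC k l G c P : pairing k l G (c%:P%:P * P) = c *: pairing k l G P.
Proof.
rewrite scaler_sumr; apply: eq_bigr => i _; rewrite scaler_sumr.
by apply: eq_bigr => j _; rewrite !coefCM scalerA.
Qed.

Lemma pairing_mul_a k l G P : pairing k l G ('X * P) = pairing k l (shift_a G) P.
Proof.
rewrite /pairing big_ord_recl big1 ?add0r => [|j _]; last by rewrite coefXM coef0 scale0r.
rewrite big_ord_recr [X in _ = _ + X]big1 ?addr0 => [|j _]; last first.
  by rewrite /shift_a subnn scaler0.
apply: eq_bigr => i _; apply: eq_bigr => j _ /=.
have -> : (bump 0 i = i.+1)%N by [].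
rewrite coefXM /shift_a; have -> : (k - i == 0)%N = false by have := ltn_ord i; lia.
by congr (_ *: G _ _ _); lia.
Qed.

Lemma pairing_mul_b k l G P : pairing k l G ('X%:P * P) = pairing k l (shift_b G) P.
Proof.
apply: eq_bigr => i _.
rewrite big_ord_recl coefCM coefXM scale0r add0r.
rewrite big_ord_recr [X in _ = _ + X](_ : _ = 0) ?addr0; last first.
  by rewrite /shift_b subnn scaler0.
apply: eq_bigr => j _ /=.
have -> : (bump 0 j = j.+1)%N by [].
rewrite coefXM /shift_b; have -> : (l - j == 0)%N = false by have := ltn_ord j; lia.
by congr (_ *: G _ _ _); lia.
Qed.

Definition lin_ab (x y : F) : {poly {poly F}} := x%:P%:P * 'X + y%:P%:P * 'X%:P.

Lemma coef_lin_ab_exp x y s i j :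
  (lin_ab x y ^+ s)`_i`_j = ('C(s, i) * (i + j == s))%:R * x ^+ i * y ^+ j.
Proof.
elim: s i j => [|s IH] i j.
  rewrite expr0 coef1; case: i => [|i] /=; last by rewrite coef0 mul0n !mul0r.
  by rewrite coef1 bin0 mul1n mulr1; case: j => [|j]; rewrite ?(mulr1, mul0r).
rewrite exprS mulrDl -!mulrA !coefD !coefCM !coefXM.
case: i => [|i]; case: j => [|j] /=; rewrite ?IH ?coef0 ?mulr0 ?add0r ?addr0.
- by rewrite muln0 !mul0r.
- by rewrite !bin0 eqSS exprS; ring.
- rewrite eqSS binS exprS; case: eqP => [->|_]; last by rewrite !muln0 !mul0r mulr0.
  by rewrite (bin_small (ltnSn s)); ring.
have -> : (i.+1 + j.+1 == s.+1)%N = (i + j.+1 == s)%N by [].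
have -> : (i.+1 + j == s)%N = (i + j.+1 == s)%N by rewrite addSnnS.
rewrite binS !exprS; case: eqP => _; rewrite ?muln0 ?muln1; last by ring.
by rewrite natrD; ring.
Qed.

Lemma pairing_lin_ab_exp k l G P x y s :
  (k + l < s)%N -> pairing k l G (lin_ab x y ^+ s * P) = 0.
Proof.
move=> kls; rewrite /pairing big1 // => i _; rewrite big1 // => j _.
rewrite (coefM_eq0 (P := lin_ab x y ^+ s)) ?scale0r // => i' j' ii jj.
have -> : ((lin_ab x y ^+ s)`_i')`_j' = 0.
  rewrite coef_lin_ab_exp (_ : (i' + j' == s)%N = false) ?muln0 ?mul0r //.
  by have := ltn_ord i; have := ltn_ord j; lia.
by [].
Qed.

(** The hypothesis says that 1 - (x a + y b) for G corresponds to
    1 - (x' a + y' b) for D.  Applying it to a times the product of both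
    truncated inverses moves the inverse to the other side. *)
Lemma pairing_inv k l G D x y x' y' :
    (forall a k l, G a k l - x *: shift_a G a k l - y *: shift_b G a k l
      = D a k l - x' *: shift_a D a k l - y' *: shift_b D a k l) ->
  pairing k l G ('X * \sum_(s < (k + l).+1) lin_ab x' y' ^+ s)
  = pairing k l D ('X * \sum_(s < (k + l).+1) lin_ab x y ^+ s).
Proof.
move=> GD; set X := \sum_(s < _) lin_ab x' y' ^+ s; set Y := \sum_(s < _) _.
have eqGD P : pairing k l G ((1 - lin_ab x y) * P) = pairing k l D ((1 - lin_ab x' y') * P).
  have step H u v : pairing k l H ((1 - lin_ab u v) * P)
      = pairing k l (fun a k l => H a k l - u *: shift_a H a k l - v *: shift_b H a k l) P.
    have -> : (1 - lin_ab u v) * P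
        = P + (- u)%:P%:P * ('X * P) + (- v)%:P%:P * ('X%:P * P).
      by rewrite /lin_ab !(rmorphN polyC) /=; ring.
    rewrite !pairingD !pairingC pairing_mul_a pairing_mul_b /pairing.
    rewrite !scaler_sumr -!big_split; apply: eq_bigr => i _.
    rewrite !scaler_sumr -!big_split; apply: eq_bigr => j _ /=.
    by rewrite !scalerBr !scaleNr !scalerA !(mulrC u) !(mulrC v).
  rewrite !step; apply: eq_bigr => i _; apply: eq_bigr => j _.
  by rewrite GD.
have geom u v : (1 - lin_ab u v) * (\sum_(s < (k + l).+1) lin_ab u v ^+ s)
    = 1 - lin_ab u v ^+ (k + l).+1.
  by rewrite -[RHS]opprB subrX1 -mulNr opprB.
have trunc H u v P : pairing k l H ((1 - lin_ab u v ^+ (k + l).+1) * P) = pairing k l H P.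
  have -> : (1 - lin_ab u v ^+ (k + l).+1) * P
      = P + (-1)%:P%:P * (lin_ab u v ^+ (k + l).+1 * P).
    by rewrite !(rmorphN polyC) /=; ring.
  by rewrite pairingD pairingC pairing_lin_ab_exp // scaler0 addr0.
rewrite -(trunc G x y) -geom -/Y -mulrA eqGD -[RHS](trunc D x' y') -geom -/X.
by congr (pairing k l D _); ring.
Qed.

End Pairing.

(** * The identity *)

Section Identity.
Context {F : fieldType}.

Lemma coef_sum_lin_ab (x y : F) n i j : (i + j <= n)%N ->
  ('X * \sum_(s < n.+1) lin_ab x y ^+ s)`_i`_j
  = if i is i'.+1 then 'C(i' + j, i')%:R * x ^+ i' * y ^+ j else 0.
Proof.
rewrite coefXM; case: i => [|i] lt_n /=; first by rewrite coef0.
rewrite !coef_sum.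
have ijn : (i + j < n.+1)%N by lia.
rewrite (bigD1 (Ordinal ijn)) //= coef_lin_ab_exp eqxx muln1 big1 ?addr0 // => s ne.
rewrite coef_lin_ab_exp; have -> : (i + j == s)%N = false.
  by apply: contraNF ne => /eqP E; apply/eqP/val_inj.
by rewrite muln0 !mul0r.
Qed.

(** The coefficient of z^a in g(1/z) sum_n h_n z^n, the functional underlying
    the operator C_a. *)
Definition pair_h a (g : {poly symfun F}) : symfun F :=
  \sum_(j < size g) g`_j * sf_h F (a + j)%N.

Lemma pair_hE a (g : {poly symfun F}) N : (size g <= N)%N ->
  pair_h a g = \sum_(j < N) g`_j * sf_h F (a + j)%N.
Proof.
move=> gN; rewrite /pair_h (big_ord_widen _ (fun j => g`_j * sf_h F (a + j)%N) gN).
rewrite big_mkcond; apply: eq_bigr => j _; case: ltnP => // jg.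
by rewrite nth_default ?mul0r.
Qed.

Lemma pair_hD a f g : pair_h a (f + g) = pair_h a f + pair_h a g.
Proof.
pose N := maxn (size f) (size g).
rewrite (@pair_hE a (f + g) N) ?size_polyD // (@pair_hE a f N) ?leq_maxl //.
rewrite (@pair_hE a g N) ?leq_maxr // -big_split; apply: eq_bigr => j _.
by rewrite coefD mulrDl.
Qed.

Lemma pair_hCM a c g : pair_h a (c%:P * g) = c * pair_h a g.
Proof.
have le_size : (size (c%:P * g)%R <= size g)%N by rewrite mul_polyC size_scale_leq.
rewrite (pair_hE _ le_size) mulr_sumr; apply: eq_bigr => j _.
by rewrite coefCM mulrA.
Qed.

Lemma pair_hXM a g : pair_h a ('X * g) = pair_h a.+1 g.
Proof.
have le_size : (size ('X * g)%R <= (size g).+1)%N.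
  by rewrite (leq_trans (size_polyMleq _ _)) // size_polyX.
rewrite (pair_hE _ le_size) big_ord_recl coefXM mul0r add0r.
by apply: eq_bigr => j _; rewrite coefXM /= addSnnS.
Qed.

Lemma pair_hC a c : pair_h a c%:P = c * sf_h F a.
Proof.
by rewrite (@pair_hE a c%:P 1) ?size_polyC_leq1 // big_ord1 coefC addn0.
Qed.

Lemma pair_h0 a : pair_h a 0 = 0.
Proof. by rewrite /pair_h size_poly0 big_ord0. Qed.

Context (q : F) (q_neq0 : q != 0) (char0 : forall m, m.+1%:R != 0 :> F).
Local Notation M := (signed_m F).

(** The normalisation (- 1/q)^a makes a factor w cost - q
    ([shifted_pair_rel]). *)
Definition shifted_pair a k l : symfun F :=
  (- q^-1) ^+ a *: pair_h a (pleth_shift q (M k l)).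

Definition plain_pair a k l : symfun F := (- q^-1) ^+ a *: (M k l * sf_h F a).

(** [pleth_shift_signed_m] paired with the h_n. *)
Lemma shifted_pair_rel a k l :
  shifted_pair a k l - q ^+ 2 *: shift_a shifted_pair a k l
    - q *: shift_b shifted_pair a k l
  = plain_pair a k l - 1 *: shift_a plain_pair a k l - 1 *: shift_b plain_pair a k l.
Proof.
have psum k' l' := is_psum_poly_signed_m k' l' char0.
have := congr1 (pair_h a) (pleth_shift_signed_m q k l psum).
have negE (P : {poly symfun F}) : - P = (-1)%:P * P by rewrite rmorphN mulN1r.
have ifh (b : bool) c g : pair_h c (if b then 0 else g) = if b then 0 else pair_h c g.
  by case: b; rewrite ?pair_h0.
rewrite !negE !pair_hD !pair_hCM !expr2 -!mulrA.
rewrite !pair_hXM !pair_hCM !pair_hXM !pair_hCM !pair_hXM.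
rewrite !ifh !pair_hC !mulr_algl !mulN1r !scale1r.
have ifZ (b : bool) (c : F) (f : symfun F) :
    (if b then 0 else c *: f) = c *: (if b then 0 else f).
  by case: b; rewrite ?scaler0.
rewrite /shift_a /shift_b /shifted_pair /plain_pair !ifZ !scalerA.
set r := (- q^-1) ^+ a.
have -> : q * q * (- q^-1) ^+ a.+2 = r by rewrite !exprS -/r; field.
have -> : q * (- q^-1) ^+ a.+1 = - r by rewrite exprS -/r; field.
have -> : (- q^-1) ^+ a.+2 = r * (q^-1 * q^-1) by rewrite !exprS -/r; ring.
have -> : (- q^-1) ^+ a.+1 = - (r * q^-1) by rewrite exprS -/r; ring.
rewrite !scaleNr !opprK => E.
rewrite -scalerBr -scalerDr addrAC E !scalerDr scalerN !scalerA.
by rewrite addrAC.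
Qed.

(** The relation left once the operators C_a have been eliminated; its term
    i = 0 is M_{k,l}. *)
Lemma lucas_symfun k l :
  \sum_(i < k.+1) \sum_(j < l.+1) (lucas_coef i j)%:R *:
     ((-1) ^+ j *: (M (k - i) (l - j) * sf_h F (2 * i + j)))
  = 'C(k + l, k)%:R *: sf_e F (2 * k + l).
Proof.
apply: symfunP => n.
have := @coef_prod_quad_geom {mpoly F[n]} _ (fun i : 'I_n => 'X_i)
  (2 * k + l).+1 k l (ltnSn _).
rewrite coef_prod_lin => E.
rewrite -[RHS]/('C(k + l, k)%:R *: sf_e F (2 * k + l) n) scaler_nat -mulr_natl -E.
rewrite -[LHS]/(sf_at n _) rmorph_sum; apply: eq_bigr => i _.
rewrite rmorph_sum; apply: eq_bigr => j _.
rewrite coef_prod_geom; last by have := ltn_ord i; have := ltn_ord j; lia.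
rewrite coef_prod_quad exprD exprM sqrrN !expr1n mul1r -[LHS]/(_ *: (_ *: (_ * _))).
by rewrite -!mul_mpolyC rmorph_sign rmorph_nat; ring.
Qed.

(** [pairing_inv] for 1 - q^2 a - q b against 1 - a - b: the powers of q in the
    coefficients of a/(1 - q^2 a - q b) cancel the normalisation of
    [plain_pair] up to q^2. *)
Lemma sum_shifted_pair k l :
  q ^+ 2 *: (\sum_(i < k) \sum_(j < l.+1)
     'C(i + j, i)%:R *: shifted_pair (2 * i.+1 + j) (k - i.+1) (l - j))
  = \sum_(i < k) \sum_(j < l.+1)
     'C(i + j, i)%:R *: ((-1) ^+ j *: (M (k - i.+1) (l - j) * sf_h F (2 * i.+1 + j))).
Proof.
have pairE (G : nat -> nat -> nat -> symfun F) x y :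
    pairing k l G ('X * \sum_(s < (k + l).+1) lin_ab x y ^+ s)
    = \sum_(i < k) \sum_(j < l.+1) ('C(i + j, i)%:R * x ^+ i * y ^+ j)
        *: G (2 * i.+1 + j)%N (k - i.+1)%N (l - j)%N.
  rewrite /pairing big_ord_recl big1 ?add0r => [|j _]; last first.
    by rewrite coef_sum_lin_ab ?scale0r //=; have := ltn_ord j; lia.
  apply: eq_bigr => i _; apply: eq_bigr => j _.
  rewrite coef_sum_lin_ab //.
  by have := ltn_ord i; have := ltn_ord j; rewrite /= /bump /=; lia.
have := pairing_inv k l shifted_pair_rel.
rewrite !pairE; under eq_bigr => i _ do under eq_bigr => j _ do
  rewrite !expr1n !mulr1.
move=> ->; rewrite scaler_sumr; apply: eq_bigr => i _.
rewrite scaler_sumr; apply: eq_bigr => j _.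
rewrite /plain_pair !scalerA; congr (_ *: _).
have -> : (- q^-1) ^+ (2 * i.+1 + j) = (-1) ^+ j * (q ^+ 2) ^- i.+1 * q ^- j.
  have qj : (- q^-1) ^+ j = (-1) ^+ j * q ^- j by rewrite (exprNn q^-1) exprVn.
  by rewrite exprD exprM sqrrN !exprVn qj; ring.
have : (q ^+ 2) ^+ i != 0 by rewrite !expf_neq0.
have : q ^+ j != 0 by rewrite expf_neq0.
rewrite [(q ^+ 2) ^+ i.+1]exprS; move: (q ^+ j) ((q ^+ 2) ^+ i) => u v u0 v0.
by field; rewrite u0 v0 q_neq0.
Qed.

Lemma sf_h0 : sf_h F 0 = 1.
Proof.
(* At truncation order 1 every geometric factor is 1. *)
apply: symfunP => n; have := @coef_prod_geom F n 1 0 isT.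
rewrite expr0 mul1r => <-; rewrite big1 => [|i _]; last by rewrite big_ord1 expr0.
by rewrite coef1 /= mpolyC1.
Qed.

Lemma scale_Cop a f :
  q *: Cop q a.+1%:Z f
  = - (q ^+ 2 *: ((- q^-1) ^+ a.+1 *: pair_h a.+1 (pleth_shift q f))).
Proof.
rewrite /Cop (_ : a.+1%:Z - 1 = a%:Z); last by lia.
rewrite -[_ ^ a%:Z]/(_ ^+ a) -/(pair_h a.+1 _) !scalerA -scaleNr.
by congr (_ *: _); rewrite [(- q^-1) ^+ a.+1]exprS; field.
Qed.

(** Since q C_a is - q^2 times the normalised pairing, the double sum is minus the
    left side of [sum_shifted_pair], which [lucas_symfun] evaluates. *)
Theorem signed_m_expansion k l :
  M k l = 'C(k + l, k)%:R *: sf_e F (2 * k + l)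
    + q *: \sum_(1 <= i < k.+1) \sum_(0 <= j < l.+1)
        'C(i - 1 + j, i - 1)%:R *: Cop q (2 * i + j)%N%:Z (M (k - i) (l - j)).
Proof.
rewrite big_add1 big_mkord.
rewrite [X in _ + X](_ : _ = - (q ^+ 2 *: (\sum_(i < k) \sum_(j < l.+1)
    'C(i + j, i)%:R *: shifted_pair (2 * i.+1 + j) (k - i.+1) (l - j)))); last first.
  rewrite scaler_sumr scaler_sumr -sumrN; apply: eq_bigr => i _.
  rewrite big_mkord !scaler_sumr -sumrN; apply: eq_bigr => j _.
  rewrite subn1 /= scalerA mulrC -scalerA.
  have -> : (2 * i.+1 + j = (2 * i + j).+1.+1)%N by lia.
  by rewrite scale_Cop scalerN /shifted_pair !scalerA [_ * q ^+ 2]mulrC.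
rewrite sum_shifted_pair -lucas_symfun big_ord_recl.
rewrite big_ord_recl /= big1 ?addr0 => [|j _]; last by rewrite scale0r.
rewrite !scale1r !subn0 sf_h0 mulr1.
by apply/esym/addrK.
Qed.

End Identity.

Lemma qvar_neq0 : qvar != 0.
Proof.
rewrite tofrac_eq0; apply/eqP => /(congr1 (mcoeff U_(0%R)%MM)) /eqP.
by rewrite mcoeffX eqxx mcoeff0 oner_eq0.
Qed.

Lemma Qqt_char0 m : m.+1%:R != 0 :> Qqt.
Proof.
rewrite -(rmorph_nat (@FracField.tofrac _)) tofrac_eq0.
by rewrite -(rmorph_nat (@mpolyC 2 rat)) mpolyC_eq0 Num.Theory.pnatr_eq0.
Qed.

Theorem theorem1p9 (k l : nat) (hk : (0 < k)%N) :
  (-1) ^+ k *: sf_m Qqt (nseq k 2%N ++ nseq l 1%N)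
  = 'C((k + l)%N, k)%:R *: sf_e Qqt (2 * k + l)%N
    + qvar *: \sum_(1 <= i < k.+1) \sum_(0 <= j < l.+1)
        'C((i - 1 + j)%N, (i - 1)%N)%:R *:
          Cop qvar (2 * i + j)%N%:Z
            ((-1) ^+ (k - i)%N *:
               sf_m Qqt (nseq (k - i)%N 2%N ++ nseq (l - j)%N 1%N))
  :> symfun Qqt.
Proof. exact: signed_m_expansion qvar_neq0 Qqt_char0 k l. Qed.
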